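(* Let $\hat\pi\in(0,1)$, $\epsilon\in(0,1)$ with $\epsilon<1-\hat\pi$, $\bar\lambda\ge 0$, and let $f_0,f_1$ be probability densities of two distinct distributions with $0<D(f_0\|f_1)<\infty$ and $0<D(f_1\|f_0)<\infty$. Let $C(\delta_L,\delta_U)$ be the cost function defined in the context. Then for every fixed $\hat\delta_U>1$ the function $\delta_L\mapsto C(\delta_L,\hat\delta_U)$ is strongly convex on $(0,1]$. Consequently, with $\delta_U^*=\frac{1-\hat\pi}{\hat\pi}\,\frac{1-\epsilon}{\epsilon}$, the $\delta_L$-component $\delta_L^*$ of the solution of the problem $$\text{minimize } C(\delta_L,\delta_U)\quad\text{subject to}\quad \delta_U\ge \frac{1-\hat\pi}{\hat\pi}\,\frac{1-\epsilon}{\epsilon},\qquad \delta_L\in[0,1],$$ exists, is unique, and is given by $$\delta_L^*=\underset{\delta_L\in[0,1]}{\arg\min}\; C(\delta_L,\delta_U^* ).$$ Furthermore, if $\bar\lambda>0$ then $\delta_L^*\in(0,1)$.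
   Context: $D(f\|g)=\mathbb{E}_{x\sim f}\left[\log\frac{f(x)}{g(x)}\right]$ denotes the Kullback-Leibler divergence, and $\log$ is the natural logarithm. The cost function is, for $0<\delta_L<1\le\delta_U$, $$C(\delta_L,\delta_U)=\frac{1-\hat\pi}{-D(f_0\|f_1)}\cdot\frac{\log(\delta_U)+\frac{\delta_U-1}{1-\delta_L}\log(\delta_L)}{1+\hat\pi(\delta_U-1)}+\frac{\hat\pi}{D(f_1\|f_0)}\cdot\frac{\delta_U\log(\delta_U)+\delta_L\frac{\delta_U-1}{1-\delta_L}\log(\delta_L)}{1+\hat\pi(\delta_U-1)}+\frac{\bar\lambda\,\frac{\delta_U-\delta_L}{1-\delta_L}}{1+\hat\pi(\delta_U-1)}.$$ At the endpoints $\delta_L=0$ and $\delta_L=1$, for $\delta_U>1$, $C(\delta_L,\delta_U)$ is understood as its one-sided limit in $\delta_L$, with values in $(-\infty,+\infty]$; strong convexity is understood for such extended-real-valued functions. A function $g:I\to(-\infty,+\infty]$ on an interval $I$ is strongly convex if there is $m>0$ such that $g(tx+(1-t)y)\le t g(x)+(1-t)g(y)-\frac{m}{2}t(1-t)(x-y)^2$ for all $x,y\in I$ and $t\in(0,1)$. Interpretation (not needed for the claim): $\hat\pi$ is the prior probability that a data stream is a target (density $f_1$ rather than $f_0$), $\epsilon$ is the tolerated error probability, $\bar\lambda$ is the mean switching cost, and $\delta_L,\delta_U$ are the exponentials of the lower and upper decision thresholds. *)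

(* Defs.v *)
From HB Require Import structures.
From mathcomp Require Export all_boot all_order all_algebra.
From mathcomp Require Export all_classical all_reals all_analysis.
Export Order.TTheory GRing.Theory Num.Theory.
Export numFieldNormedType.Exports.

Set Implicit Arguments.
Unset Strict Implicit.
Unset Printing Implicit Defensive.

Local Open Scope classical_set_scope.
Local Open Scope ring_scope.

Section densities.
Context (d : measure_display) (T : measurableType d) (R : realType).
Variable mu : {measure set T -> \bar R}.
Implicit Types f g : T -> R.

Definition is_density f : Prop :=
  [/\ measurable_fun [set: T] f,
      forall x, 0 <= f x &
      (\int[mu]_x (f x)%:E = 1)%E].

Definition same_distribution f g : Prop :=
  forall A, measurable A ->
    (\int[mu]_(x in A) (f x)%:E = \int[mu]_(x in A) (g x)%:E)%E.

(* Division and [lne] are the extended-real ones, so that the usual conventions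
   hold: if f x > 0 = g x the integrand is +oo (a / 0 = +oo, lne +oo = +oo),
   and if f x = 0 it is 0 (0 times anything is 0). *)
Definition KL f g : \bar R :=
  (\int[mu]_x ((f x)%:E * lne ((f x)%:E / (g x)%:E)))%E.

End densities.

Section cost.
Context (R : realType).

(* D01 and D10 stand for D(f_0 || f_1) and D(f_1 || f_0). *)
Definition cost (pi lam D01 D10 dL dU : R) : R :=
  (1 - pi) / (- D01)
    * ((ln dU + (dU - 1) / (1 - dL) * ln dL) / (1 + pi * (dU - 1)))
  + pi / D10
    * ((dU * ln dU + dL * ((dU - 1) / (1 - dL)) * ln dL)
       / (1 + pi * (dU - 1)))
  + lam * ((dU - dL) / (1 - dL)) / (1 + pi * (dU - 1)).

(* Extension of [cost] to dL = 0 and dL = 1 by one-sided limits in \bar R;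
   only meaningful for 0 <= dL <= 1 and 1 < dU. *)
Definition ext_cost (pi lam D01 D10 dL dU : R) : \bar R :=
  if dL == 0 then lim ((cost pi lam D01 D10 x dU)%:E @[x --> 0^'+])
  else if dL == 1 then lim ((cost pi lam D01 D10 x dU)%:E @[x --> 1^'-])
  else (cost pi lam D01 D10 dL dU)%:E.

(* The first clause says that g takes its values in (-oo, +oo] on I; in
   particular no sum -oo + +oo can occur in the second one. *)
Definition strongly_convex (I : interval R) (g : R -> \bar R) : Prop :=
  (forall x, x \in I -> (-oo < g x)%E) /\
  exists2 m : R, 0 < m &
    forall x y t : R, x \in I -> y \in I -> 0 < t < 1 ->
      (g (t * x + (1 - t) * y)%R <=
       t%:E * g x + (1 - t)%:E * g y
       - (m / 2 * t * (1 - t) * (x - y) ^+ 2)%:E)%E.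

Definition argmin (U : Type) (A : set U) (g : U -> \bar R) : set U :=
  [set x | A x /\ forall y, A y -> (g x <= g y)%E].

End cost.

(* Main.v *)
Require Import Defs.
From mathcomp Require Import ring lra.

Set Implicit Arguments.
Unset Strict Implicit.
Unset Printing Implicit Defensive.

Local Open Scope classical_set_scope.
Local Open Scope ring_scope.

(** Write a = (1 - pi) / D(f0||f1), b = pi / D(f1||f0), u = 1 - dL and
    phi(x) = - ln x / (1 - x), continued by phi(1) = 1. Collecting terms,
      C(x, U) = (- a ln U + b U ln U + lam + (U - 1) h(x)) / (1 + pi (U - 1)),
      h(x) = (a - b x) phi(x) + lam / (1 - x),
    so for fixed U > 1 the cost is an increasing affine image of h
    ([reduced_cost_affine]), and everything about dL is a property of h.

    Strong convexity. The logarithmic series ([cvg_ln_series]) gives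
      phi(1 - u)           = \sum_n u^n / (n + 1),
      - (1 - u) phi(1 - u) = -1 + \sum_(n >= 1) u^n / (n (n + 1)).
    All coefficients beyond the constant one are positive, so both functions
    are convex on ]0, 1], and the quadratic term u^2 / 3 of the first makes it
    strongly convex with modulus 2/3 ([convex_inv_logmean],
    [convex_neg_inv_logmean]). Since 1 / (1 - x) is convex too, h is strongly
    convex with modulus 2a/3 ([tradeoff_convex]).

    Endpoints. h tends to +oo at 0, because a > 0. At 1 it tends to +oo when
    lam > 0 and to the finite value a - b when lam = 0. Hence the extended
    cost is finite exactly on [cost_domain], and there it is given by the
    formula above ([ext_cost_fin], [ext_cost_pinfty]). A minimizer over [0, 1]
    exists: if lam > 0 by compactness, as the cost blows up at both ends, so
    that it is interior; if lam = 0 at dL = 1, where h reaches its lower bound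
    a - b. It is unique by strong convexity ([ext_cost_argmin]).

    Joint problem. For each dL the cost is nondecreasing in U >= 1
    ([reduced_cost_nondecreasing]), from the bound h >= a - b + lam and the
    elementary estimates 1 - 1/y <= ln y <= y - 1. Since eps < 1 - pi means
    dUs > 1, lowering U to dUs never increases the cost, so the dL-component
    of any joint solution minimizes C(., dUs), and conversely. *)

(** * The logarithmic series *)

Section logarithm.
Context {R : realType}.
Implicit Types x u : R.

Lemma ln_le_subr1 x : 0 < x -> ln x <= x - 1.
Proof.
move=> x0; have := @le_ln1Dx R (x - 1).
rewrite (_ : 1 + (x - 1) = x) => [|]; [apply; lra|ring].
Qed.

Lemma ln_ge_sub1V x : 0 < x -> 1 - x^-1 <= ln x.
Proof.
move=> x0; have := @ln_le_subr1 x^-1.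
rewrite invr_gt0 lnV ?posrE// => /(_ x0); lra.
Qed.

Definition ln_series u n : R := \sum_(k < n) u ^+ k.+1 / k.+1%:R.

Lemma is_derive_ln_series n x :
  is_derive x 1 (ln_series ^~ n) (\sum_(k < n) x ^+ k).
Proof.
elim: n => [|n ih].
  rewrite big_ord0; have -> : ln_series ^~ 0%N = cst 0 :> (R -> R).
    by apply/funext => u; rewrite /ln_series big_ord0.
  exact: is_derive_cst.
have -> : ln_series ^~ n.+1
    = (ln_series ^~ n) + n.+1%:R^-1 \*: (fun u : R => u ^+ n.+1) :> (R -> R).
  by apply/funext => u; rewrite /ln_series big_ord_recr/= mulrC.
rewrite big_ord_recr/=; apply: is_deriveD.
have h : is_derive x 1 (fun u : R => u ^+ n.+1) (n.+1%:R * x ^+ n).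
  apply: DeriveDef; first exact: exprn_derivable.
  by rewrite exp_derive scaler1.
apply: is_derive_eq.
by rewrite /GRing.scale/= mulKf ?pnatr_eq0.
Qed.

(** The remainder vanishes at 0 and its derivative is
    1 / (1 - v) - \sum_(k < n) v^k = v^n / (1 - v), which on [0, u] lies
    between 0 and u^n / (1 - u); the mean value theorem does the rest. *)
Lemma ln_series_remainder u n : 0 <= u < 1 ->
  0 <= - ln (1 - u) - ln_series u n <= u ^+ n.+1 / (1 - u).
Proof.
move=> /andP[u0 u1].
pose f v := - ln (1 - v) - ln_series v n.
pose df v : R := (1 - v)^-1 - \sum_(k < n) v ^+ k.
have f' (v : R) : v < 1 -> is_derive v (1 : R) f (df v).
  move=> v1; apply: is_deriveB; last exact: is_derive_ln_series.
  have v1' : 0 < 1 - v by lra.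
  have h1 : is_derive v 1 (fun v : R => 1 - v) (-1).
    rewrite -[X in is_derive _ _ _ X]sub0r.
    exact: is_deriveB.
  have h2 := is_derive1_ln v1'.
  
  have h4 : is_derive v 1 (@ln R \o (fun v : R => 1 - v)) ((1 - v)^-1 * -1).
    exact: is_derive1_comp.
  by have := is_deriveN h4; rewrite mulrN1 opprK.
have df_eq v : v < 1 -> df v = v ^+ n / (1 - v).
  move=> v1; have v1' : 1 - v != 0 by apply/eqP; lra.
  apply: (mulIf v1'); rewrite mulrBl mulVf// divfK//.
  have /(congr1 (+%R 1)) := subrX1 v n; rewrite subrKC => ->; ring.
have [c /[!in_itv]/= /andP[c0 cu]] : exists2 c, c \in `[0, u] &
    f u - f 0 = df c * (u - 0).
  apply: MVT_segment => //.
    move=> x /[!in_itv]/= /andP[_ xu]; apply: f'; lra.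
  apply: derivable_within_continuous => x /[!in_itv]/= /andP[_ xu].
  have [] // := f' x _; lra.
have -> : f 0 = 0.
  rewrite /f subr0 ln1 oppr0 sub0r /ln_series big1 ?oppr0// => k _.
  by rewrite expr0n mul0r.
rewrite !subr0 -/(f u) df_eq ?(le_lt_trans cu)// => ->.
have c1 : 0 < 1 - c by lra.
have u1' : 0 < 1 - u by lra.
apply/andP; split; first by rewrite mulr_ge0// divr_ge0 ?exprn_ge0// ltW.
rewrite mulrAC exprSr; apply: ler_pM.
- by rewrite mulr_ge0// exprn_ge0.
- by rewrite invr_ge0 ltW.
- by rewrite ler_wpM2r// lerXn2r ?nnegrE.
- by rewrite lef_pV2 ?posrE// lerB.
Qed.

Lemma cvg_ln_series u : 0 <= u < 1 -> ln_series u @ \oo --> - ln (1 - u).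
Proof.
move=> /andP[u0 u1].
have r0 : (fun n => u ^+ n.+1 / (1 - u)) @ \oo --> 0.
  rewrite -[X in _ --> X](mul0r (1 - u)^-1); apply: cvgMl.
  by rewrite (cvg_shiftS (fun n => u ^+ n)); apply: cvg_expr; rewrite ger0_norm.
have : (fun n => - ln (1 - u) - ln_series u n) @ \oo --> 0.
  apply: (squeeze_cvgr _ (cvg_cst 0) r0); near=> n.
  by apply: ln_series_remainder; rewrite u0.
move=> /(cvgB (cvg_cst (- ln (1 - u)))); rewrite subr0.
by apply: cvg_trans; apply: near_eq_cvg; near=> n; rewrite !fctE subKr.
Unshelve. all: by end_near. Qed.

End logarithm.

(** * Convexity with a prescribed modulus *)

Section modulus_of_convexity.
Context {R : realType}.
Implicit Types (I J : interval R) (m c : R) (f g : R -> R).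

(** The modulus m may vanish, in which case this is plain convexity; this lets
    convex and strongly convex summands be added in one calculus. *)
Definition convex_with_modulus I m f := forall x y t,
  x \in I -> y \in I -> 0 < t < 1 ->
  f (t * x + (1 - t) * y)
    <= t * f x + (1 - t) * f y - m / 2 * t * (1 - t) * (x - y) ^+ 2.

Lemma conv_in_itv I x y t : x \in I -> y \in I -> 0 < t < 1 ->
  t * x + (1 - t) * y \in I.
Proof.
move=> xI yI /andP[t0 t1].
have [xy|yx] := leP x y; [apply: (@interval_is_interval _ I x y)|
  apply: (@interval_is_interval _ I y x)] => //; nra.
Qed.

Lemma convex_with_modulus_sub I J m f : {subset J <= I} ->
  convex_with_modulus I m f -> convex_with_modulus J m f.
Proof. by move=> JI fI x y t xJ yJ; apply: fI; exact: JI. Qed.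

Lemma eq_convex_with_modulus I m f g : convex_with_modulus I m f ->
  {in I, f =1 g} -> convex_with_modulus I m g.
Proof.
by move=> fI fg x y t xI yI t01; rewrite -!fg ?fI// conv_in_itv.
Qed.

Lemma convex_with_modulus_cst I c : convex_with_modulus I 0 (cst c).
Proof. by move=> x y t _ _ _; rewrite /cst; lra. Qed.

Lemma convex_with_modulusD I m1 m2 f g :
  convex_with_modulus I m1 f -> convex_with_modulus I m2 g ->
  convex_with_modulus I (m1 + m2) (f \+ g).
Proof.
move=> fI gI x y t xI yI t01 /=.
have := fI x y t xI yI t01; have := gI x y t xI yI t01; lra.
Qed.

Lemma convex_with_modulusZ I m c f : 0 <= c ->
  convex_with_modulus I m f -> convex_with_modulus I (c * m) (c \*o f).
Proof.
move=> c0 fI x y t xI yI t01 /=.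
by have := ler_wpM2l c0 (fI x y t xI yI t01); lra.
Qed.

Lemma convex_with_modulus_sum I (F : nat -> R -> R) n :
  (forall k, convex_with_modulus I 0 (F k)) ->
  convex_with_modulus I 0 (fun x => \sum_(k < n) F k x).
Proof.
move=> FI; elim: n => [|n ih].
  apply: eq_convex_with_modulus (@convex_with_modulus_cst _ 0) _ => x _.
  by rewrite big_ord0.
rewrite -[X in convex_with_modulus _ X _]addr0.
apply: eq_convex_with_modulus (convex_with_modulusD ih (FI n)) _ => x _.
by rewrite big_ord_recr.
Qed.

Lemma convex_with_modulus_cvg I m (F : nat -> R -> R) f :
  (forall n, convex_with_modulus I m (F n)) ->
  {in I, forall x, F ^~ x @ \oo --> f x} -> convex_with_modulus I m f.
Proof.
move=> FI Ff x y t xI yI t01.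
have Fz := Ff _ (conv_in_itv xI yI t01).
apply: (ler_cvg_to Fz).
  apply: cvgB; last exact: cvg_cst.
  by apply: cvgD; apply: cvgMr; exact: Ff.
by near=> n; exact: FI.
Unshelve. all: by end_near. Qed.

Lemma convex_with_modulus_sub1 m f : convex_with_modulus `[0, 1[ m f ->
  convex_with_modulus `]0, 1] m (fun x => f (1 - x)).
Proof.
move=> fI x y t; rewrite !in_itv/= => /andP[x0 x1] /andP[y0 y1] t01.
have := fI (1 - x) (1 - y) t; rewrite !in_itv/= => /(_ _ _ t01).
rewrite (_ : t * (1 - x) + _ = 1 - (t * x + (1 - t) * y)); last by ring.
rewrite (_ : (1 - x - _) ^+ 2 = (x - y) ^+ 2); last by ring.
by apply; lra.
Qed.

(** Induction on n: with z the convex combination of x and y, the defect of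
    convexity of x^(n+1) is at least t (1 - t) (x - y) (x^n - y^n), which is
    nonnegative because powers are monotone on nonnegative numbers. *)
Lemma convex_exprn n : convex_with_modulus `[0, 1[ 0 (fun x : R => x ^+ n).
Proof.
elim: n => [|n ih] x y t xI yI t01.
  by rewrite !expr0; lra.
have := ih x y t xI yI t01; move: xI yI t01.
rewrite !in_itv/= => /andP[x0 _] /andP[y0 _] /andP[t0 t1].
set z := t * x + (1 - t) * y; rewrite !mul0r !subr0 => zn.
have z0 : 0 <= z by rewrite /z; nra.
rewrite !exprS; apply: le_trans (ler_wpM2l z0 zn) _.
have xy : 0 <= (x - y) * (x ^+ n - y ^+ n).
  have [xy|/ltW yx] := leP x y.
    by rewrite mulr_le0// subr_le0// lerXn2r.
  by rewrite mulr_ge0// subr_ge0// lerXn2r.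
rewrite -subr_ge0 (_ : _ - _ = t * (1 - t) * ((x - y) * (x ^+ n - y ^+ n))).
  by rewrite mulr_ge0// mulr_ge0; lra.
by rewrite /z; ring.
Qed.

Lemma convex_sub1V : convex_with_modulus `]0, 1[ 0 (fun x : R => (1 - x)^-1).
Proof.
move=> x y t; rewrite !in_itv/= => /andP[x0 x1] /andP[y0 y1] /andP[t0 t1].
have p0 : 0 < 1 - x by lra.
have q0 : 0 < 1 - y by lra.
have z0 : 0 < 1 - (t * x + (1 - t) * y) by nra.
rewrite -subr_ge0.
rewrite (_ : _ - _ = t * (1 - t) * (x - y) ^+ 2
   / ((1 - x) * (1 - y) * (1 - (t * x + (1 - t) * y)))).
  apply: divr_ge0; first by rewrite mulr_ge0 ?sqr_ge0// mulr_ge0; lra.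
  by rewrite !mulr_ge0// ltW.
by field; rewrite !gt_eqF//.
Qed.

End modulus_of_convexity.

(** * The function - ln x / (1 - x) *)

Section inv_logmean.
Context {R : realType}.
Implicit Types x u : R.

(** The reciprocal of the logarithmic mean of x and 1; the value at 1 is the
    limit there. *)
Definition inv_logmean x : R := if x == 1 then 1 else - ln x / (1 - x).

Lemma inv_logmean1 : inv_logmean 1 = 1.
Proof. by rewrite /inv_logmean eqxx. Qed.

Lemma inv_logmean_lt1 x : x < 1 -> inv_logmean x = - ln x / (1 - x).
Proof. by rewrite /inv_logmean => /lt_eqF ->. Qed.

Lemma inv_logmean_ge1 x : 0 < x <= 1 -> 1 <= inv_logmean x.
Proof.
move=> /andP[x0]; rewrite le_eqVlt => /predU1P[->|x1].
  by rewrite inv_logmean1.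
by rewrite inv_logmean_lt1// ler_pdivlMr; have := ln_le_subr1 x0; lra.
Qed.

Lemma inv_logmean_le_inv x : 0 < x <= 1 -> x * inv_logmean x <= 1.
Proof.
move=> /andP[x0]; rewrite le_eqVlt => /predU1P[->|x1].
  by rewrite inv_logmean1 mulr1.
rewrite inv_logmean_lt1// mulrA ler_pdivrMr ?mul1r; last lra.
have := ler_wpM2l (ltW x0) (ln_ge_sub1V x0).
by rewrite mulrBr divff ?gt_eqF//; lra.
Qed.

Lemma cvg_inv_logmean u : 0 <= u < 1 ->
  (fun n => \sum_(k < n) u ^+ k / k.+1%:R) @ \oo --> inv_logmean (1 - u).
Proof.
move=> /andP[]; rewrite le_eqVlt => /predU1P[<- _|u0 u1].
  rewrite subr0 inv_logmean1; apply: cvg_near_cst; exists 1%N => // -[//|n] _.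
  rewrite big_ord_recl/= expr0 divr1 big1 ?addr0// => k _.
  by rewrite expr0n/= mul0r.
rewrite inv_logmean_lt1 ?subKr; last lra.
have : (fun n => ln_series u n / u) @ \oo --> - ln (1 - u) / u.
  by apply: cvgMl; apply: cvg_ln_series; rewrite ltW.
apply: cvg_trans; apply: near_eq_cvg; near=> n.
rewrite /ln_series mulr_suml; apply: eq_bigr => k _.
by rewrite exprSr mulrAC mulfK// gt_eqF.
Unshelve. all: by end_near. Qed.

(** A limit of polynomials in u = 1 - x with nonnegative coefficients. The
    partial sums are started at three terms so that each of them contains
    u^2 / 3, the source of the modulus 2/3. *)
Lemma convex_inv_logmean :
  convex_with_modulus `]0, 1] (2 / 3) inv_logmean.
Proof.
pose F n u : R := \sum_(k < n.+3) u ^+ k / k.+1%:R.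
pose G (u : R) : R := inv_logmean (1 - u).
suff : convex_with_modulus `[0, 1[ (2 / 3) G.
  move=> /convex_with_modulus_sub1 /eq_convex_with_modulus; apply=> x _.
  by rewrite /G subKr.
apply: (@convex_with_modulus_cvg _ _ _ F) => [n|u]; last first.
  rewrite in_itv/= => /cvg_inv_logmean.
  by rewrite /F -(cvg_shiftn 3); under [X in X @ _ --> _ -> _]eq_fun do rewrite addn3.
elim: n => [x y t _ _ _|n ih].
  by rewrite /F !big_ord_recr !big_ord0/=; lra.
have := convex_with_modulusD ih (convex_with_modulusZ _ (@convex_exprn _ n.+3)).
move=> /(_ n.+4%:R^-1); rewrite invr_ge0 ler0n mulr0 addr0 => /(_ erefl).
move=> /eq_convex_with_modulus; apply=> x _.
by rewrite /F [RHS]big_ord_recr/= [_^-1 * _]mulrC.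
Qed.

(** Here the partial sums F n are - (1 - u) times those of phi(1 - u);
    telescoping 1/k - 1/(k + 1) turns them into polynomials whose only negative
    coefficient is the constant one. *)
Lemma convex_neg_inv_logmean :
  convex_with_modulus `]0, 1] 0 (fun x => - (x * inv_logmean x)).
Proof.
pose F n u : R := - ((1 - u) * \sum_(k < n.+1) u ^+ k / k.+1%:R).
pose G (u : R) : R := - ((1 - u) * inv_logmean (1 - u)).
have FE n u : F n u = -1 + (\sum_(k < n) (k.+1 * k.+2)%:R^-1 * u ^+ k.+1
    + n.+1%:R^-1 * u ^+ n.+1).
  elim: n => [|n ih].
    by rewrite /F big_ord_recr !big_ord0/=; field.
  rewrite big_ord_recr/=.
  rewrite {1}/F big_ord_recr/= mulrDr opprD -/(F n u) ih natrM.
  by rewrite !exprS; field; rewrite nat1r -natrD !pnatr_eq0.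
suff : convex_with_modulus `[0, 1[ 0 G.
  move=> /convex_with_modulus_sub1 /eq_convex_with_modulus; apply=> x _.
  by rewrite /G subKr.
apply: (@convex_with_modulus_cvg _ _ _ F) => [n|u]; last first.
  rewrite in_itv/= => /cvg_inv_logmean; rewrite -(cvg_shiftS) => uc.
  by apply: cvgN; apply: cvgMr.
have pow c k : 0 <= c -> convex_with_modulus `[0, 1[ 0 (fun x : R => c * x ^+ k).
  by move=> c0; have := convex_with_modulusZ c0 (@convex_exprn _ k); rewrite mulr0.
have sumI : convex_with_modulus `[0, 1[ 0
    (fun x => \sum_(k < n) (k.+1 * k.+2)%:R^-1 * x ^+ k.+1).
  apply: (@convex_with_modulus_sum _ _ (fun k x => (k.+1 * k.+2)%:R^-1 * x ^+ k.+1)).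
  by move=> k; apply: pow; rewrite invr_ge0.
have lastI : convex_with_modulus `[0, 1[ 0 (fun x : R => n.+1%:R^-1 * x ^+ n.+1).
  by apply: pow; rewrite invr_ge0.
have := convex_with_modulusD (@convex_with_modulus_cst _ _ (-1))
  (convex_with_modulusD sumI lastI).
by rewrite !addr0 => /eq_convex_with_modulus; apply=> x _; rewrite FE.
Qed.

End inv_logmean.

(** * Existence and uniqueness of minimizers *)

Section minimization.
Context {R : realType}.

(** Near both ends f exceeds its value at the midpoint p, so its minimum over a
    compact subinterval containing p is global. *)
Lemma coercive_min (a b : R) (f : R -> R) : a < b ->
  {in `]a, b[, continuous f} ->
  f @ a^'+ --> +oo -> f @ b^'- --> +oo ->
  exists2 c, c \in `]a, b[ & forall x, x \in `]a, b[ -> f c <= f x.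
Proof.
move=> ab fC fa fb; pose p := (a + b) / 2.
have [al [a_al alp alf]] : exists al, [/\ a < al, al < p &
    forall x, a < x -> x <= al -> f p <= f x].
  have /cvgryPge/(_ (f p)) := fa; rewrite near_withinE => -[/= e e0 He].
  exists (Num.min (a + e / 2) ((a + p) / 2)).
  split.
  - by rewrite lt_min /p; apply/andP; split; lra.
  - by rewrite gt_min /p; apply/orP; right; lra.
  move=> x ax; rewrite le_min => /andP[xe _]; apply: He => //=.
  by rewrite distrC ger0_norm; lra.
have [be [be_b pbe bef]] : exists be, [/\ be < b, p < be &
    forall x, be <= x -> x < b -> f p <= f x].
  have /cvgryPge/(_ (f p)) := fb; rewrite near_withinE => -[/= e e0 He].
  exists (Num.max (b - e / 2) ((b + p) / 2)).
  split.
  - by rewrite gt_max /p; apply/andP; split; lra.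
  - by rewrite lt_max /p; apply/orP; right; lra.
  move=> x; rewrite ge_max => /andP[xe _] xb; apply: He => //=.
  by rewrite ger0_norm; lra.
have [||c /[!in_itv]/= /andP[alc cbe] cmin] := @EVT_min _ f al be.
- by lra.
- apply: continuous_in_subspaceT => x; rewrite inE/= in_itv/= => /andP[alx xbe].
  by apply: fC; rewrite in_itv/=; lra.
exists c => [|x]; rewrite in_itv/=; first by lra.
move=> /andP[ax xb].
have cp : f c <= f p by apply: cmin; rewrite in_itv/=; lra.
have [xal|alx] := leP x al; first exact: le_trans cp (alf _ ax xal).
have [bex|xbe] := leP be x; first exact: le_trans cp (bef _ bex xb).
by apply: cmin; rewrite in_itv/=; lra.
Qed.

(** At the midpoint of two minimizers x and y, g would fall below its minimum by
    m (x - y)^2 / 8. *)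
Lemma strongly_convex_argmin_uniq (I : interval R) (g : R -> \bar R) x y r :
  strongly_convex I g -> x \in I -> y \in I -> g x = r%:E -> g y = r%:E ->
  (forall z, z \in I -> (r%:E <= g z)%E) -> x = y.
Proof.
move=> [_ [m m0 gI]] xI yI gx gy gmin.
have h2 : 0 < (2^-1 : R) < 1 by lra.
have := le_trans (gmin _ (conv_in_itv xI yI h2)) (gI x y _ xI yI h2).
rewrite gx gy -!EFinM -!EFinD lee_fin => h.
apply/eqP; rewrite -subr_eq0 -(sqrf_eq0 (x - y)).
have := sqr_ge0 (x - y); rewrite le_eqVlt => /predU1P[<-//|xy0].
by have := mulr_gt0 m0 xy0; lra.
Qed.

Lemma cvgy_affine (T : Type) (F : set_system T) {FF : Filter F} (f : T -> R) A c :
  0 < c -> f @ F --> +oo -> (fun x => A + c * f x) @ F --> +oo.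
Proof.
move=> c0 /cvgryPge fy; apply/cvgryPge => M.
have := fy ((M - A) / c); apply: filterS => x.
by rewrite ler_pdivrMr//; lra.
Qed.

End minimization.

(** * The cost in reduced form *)

Section cost_function.
Context {R : realType}.
Variables (pi a b lam : R).
Hypotheses (pi01 : 0 < pi < 1) (a0 : 0 < a) (b0 : 0 < b) (lam0 : 0 <= lam).
Implicit Types x U V : R.

(** All the dependence of the cost on dL, up to an affine map that depends on
    dU only. *)
Definition tradeoff x := (a - b * x) * inv_logmean x + lam / (1 - x).

(** Unlike [cost], this keeps its meaning at x = 1 when lam = 0, since
    [inv_logmean] is continued there and the switching term is then 0. *)
Definition reduced_cost x U :=
  (- a * ln U + b * (U * ln U) + lam + (U - 1) * tradeoff x)
    / (1 + pi * (U - 1)).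

(** The set of those dL in [0, 1] at which the extended cost is finite. *)
Definition cost_domain : interval R :=
  if lam == 0 then `]0, 1] else `]0, 1[.

Lemma mem_cost_domain x :
  (x \in cost_domain) = [&& 0 < x, x <= 1 & (x < 1) || (lam == 0)].
Proof.
rewrite /cost_domain; case: eqP => _; rewrite in_itv/= ?orbT ?andbT ?orbF//.
by case: (ltgtP x 1); rewrite ?andbF ?andbT.
Qed.

Lemma tradeoff_convex : convex_with_modulus cost_domain (a * (2 / 3)) tradeoff.
Proof.
have subI : {subset cost_domain <= `]0, 1]}.
  by move=> x; rewrite mem_cost_domain in_itv/= => /and3P[-> ->].
have := convex_with_modulusZ (ltW a0) (convex_with_modulus_sub subI convex_inv_logmean).
have := convex_with_modulusZ (ltW b0) (convex_with_modulus_sub subI convex_neg_inv_logmean).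
have lamI : convex_with_modulus cost_domain 0 (fun x => lam / (1 - x)).
  rewrite /cost_domain; case: eqP => [->|_].
    apply: eq_convex_with_modulus (@convex_with_modulus_cst _ _ 0) _ => x _.
    by rewrite mul0r.
  by have := convex_with_modulusZ lam0 convex_sub1V; rewrite mulr0.
rewrite mulr0 => bI aI.
have := convex_with_modulusD (convex_with_modulusD aI bI) lamI.
rewrite !addr0 => /eq_convex_with_modulus; apply=> x _.
by rewrite /tradeoff /=; ring.
Qed.

(** From 1 <= phi(x), x phi(x) <= 1 and lam <= lam / (1 - x). When lam = 0 the
    bound is attained at x = 1. *)
Lemma tradeoff_ge x : x \in cost_domain -> a - b + lam <= tradeoff x.
Proof.
rewrite mem_cost_domain => /and3P[x0 x1 xlam].
have x01 : 0 < x <= 1 by rewrite x0.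
have p1 := inv_logmean_ge1 x01; have p2 := inv_logmean_le_inv x01.
have lamx : lam <= lam / (1 - x).
  case/orP: xlam => [xl1|/eqP->]; last by rewrite mul0r.
  rewrite ler_pdivlMr; last lra.
  by have := mulr_ge0 lam0 (ltW x0); lra.
have := ler_wpM2l (ltW a0) p1; have := ler_wpM2l (ltW b0) p2.
by rewrite /tradeoff; lra.
Qed.

Lemma reduced_cost_affine x U : 0 < 1 + pi * (U - 1) ->
  reduced_cost x U =
    (- a * ln U + b * (U * ln U) + lam) / (1 + pi * (U - 1))
    + (U - 1) / (1 + pi * (U - 1)) * tradeoff x.
Proof. by move=> N0; rewrite /reduced_cost mulrDl mulrAC. Qed.

Lemma normalizer_gt0 U : 1 <= U -> 0 < 1 + pi * (U - 1).
Proof.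
case/andP: pi01 => pi0 _; rewrite -subr_ge0 => /(mulr_ge0 (ltW pi0)); lra.
Qed.

(** After clearing denominators the difference is a combination, with
    nonnegative coefficients, of the slack in [tradeoff_ge] and of the two sides
    of (V - U) / V <= ln (V / U) <= (V - U) / U. *)
Lemma reduced_cost_nondecreasing x U V : x \in cost_domain -> 1 <= U -> U <= V ->
  reduced_cost x U <= reduced_cost x V.
Proof.
move=> xI U1 UV; have V1 := le_trans U1 UV.
have U0 : 0 < U by lra. have V0 : 0 < V by lra.
have h := tradeoff_ge xI.
rewrite /reduced_cost ler_pdivrMr ?normalizer_gt0// mulrAC ler_pdivlMr ?normalizer_gt0//.
move: h; set w := tradeoff x; set L := ln U => h.
have L0 : 0 <= L by exact: ln_ge0.
have [r [rE rU rV]] : exists r, [/\ ln V = L + r, U * r <= V - U & V - U <= V * r].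
  exists (ln (V / U)); split.
  - by rewrite ln_div ?posrE// /L subrKC.
  - have := ler_wpM2l (ltW U0) (ln_le_subr1 (divr_gt0 V0 U0)).
    by rewrite mulrBr mulr1 mulrCA divff ?gt_eqF// mulr1.
  - have := ler_wpM2l (ltW V0) (ln_ge_sub1V (divr_gt0 V0 U0)).
    by rewrite invf_div mulrBr mulr1 mulrCA divff ?gt_eqF// mulr1.
(* Each of the four summands below is nonnegative: the first by the bound on
   w, the next two by the bounds on r = ln (V / U) and L >= 0. *)
rewrite rE -subr_ge0.
set D := (X in 0 <= X).
have -> : D = (w - (a - b + lam)) * (V - U)
  + a * ((1 - pi) * (V - U - r) + pi * (V - U - U * r + (V - U) * L))
  + b * ((1 - pi) * (V * r - (V - U) + (V - U) * L) + pi * (U * (V * r) - (V - U)))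
  + lam * ((1 - pi) * (V - U)).
  by rewrite /D; ring.
have r0 : 0 <= r by nra.
have dL : 0 <= (V - U) * L by rewrite mulr_ge0// subr_ge0.
have rUr : r <= U * r by nra.
case/andP: pi01 => pi0 pi1.
rewrite !addr_ge0// ?mulr_ge0 ?subr_ge0 ?(ltW a0) ?(ltW b0)//; try lra.
- by rewrite addr_ge0// mulr_ge0; lra.
- by rewrite addr_ge0// mulr_ge0; nra.
Qed.

(** On ]0, 1[ the tradeoff is at least - b - a ln x. *)
Lemma cvg_tradeoff0 : tradeoff x @[x --> 0^'+] --> +oo.
Proof.
have h : - b + a * - ln x @[x --> 0^'+] --> +oo.
  by apply: cvgy_affine => //; apply/cvgNry; exact: lnNy.
apply: ger_cvgy h; near=> x.
have x0 : 0 < x by near: x; exact: nbhs_right_gt.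
have x1 : x < 1 by near: x; exact: nbhs_right_lt.
have x01 : 0 < x <= 1 by rewrite x0 ltW.
have p1 := inv_logmean_ge1 x01; have p2 := inv_logmean_le_inv x01.
have p3 : - ln x <= inv_logmean x.
  rewrite inv_logmean_lt1// ler_pdivlMr; last lra.
  by have := ln_lt0 (introT andP (conj x0 x1)); nra.
have l0 : 0 <= lam / (1 - x) by rewrite divr_ge0//; lra.
have := ler_wpM2l (ltW a0) p3; have := ler_wpM2l (ltW b0) p2.
by rewrite /tradeoff; lra.
Unshelve. all: by end_near. Qed.

(** On ]0, 1[ the tradeoff is at least - b + lam / (1 - x). *)
Lemma cvg_tradeoff1_pinfty : 0 < lam -> tradeoff x @[x --> 1^'-] --> +oo.
Proof.
move=> lam_gt0.
have h : - b + lam * (1 - x)^-1 @[x --> 1^'-] --> +oo.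
  apply: cvgy_affine => //; apply/cvgrVy.
    by near=> x; rewrite subr_gt0; near: x; exact: nbhs_left_lt.
  apply: cvg_at_left_filter; rewrite -[X in _ --> X](subrr 1).
  by apply: cvgB; [exact: cvg_cst|exact: cvg_id].
apply: ger_cvgy h; near=> x.
have x0 : 0 < x by near: x; exact: nbhs_left_gt.
have x1 : x < 1 by near: x; exact: nbhs_left_lt.
have x01 : 0 < x <= 1 by rewrite x0 ltW.
have p1 := inv_logmean_ge1 x01; have p2 := inv_logmean_le_inv x01.
have := ler_wpM2l (ltW a0) p1; have := ler_wpM2l (ltW b0) p2.
by rewrite /tradeoff/=; move: a0; lra.
Unshelve. all: by end_near. Qed.

Lemma cvg_inv_logmean1 : @inv_logmean R x @[x --> 1^'-] --> (1 : R).
Proof.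
have h : x^-1 @[x --> (1 : R)^'-] --> (1 : R).
  apply: cvg_at_left_filter; rewrite -[X in _ --> X]invr1.
  by apply: cvgV => //; exact: cvg_id.
apply: (@squeeze_cvgr _ _ _ _ (cst 1) _ _ _ _ (cvg_cst _) h); near=> x.
have x0 : 0 < x by near: x; exact: nbhs_left_gt.
have x1 : x <= 1 by near: x; exact: nbhs_left_le.
have x01 : 0 < x <= 1 by rewrite x0.
rewrite inv_logmean_ge1//= -[leRHS]mul1r ler_pdivlMr// mulrC.
exact: inv_logmean_le_inv.
Unshelve. all: by end_near. Qed.

Lemma cvg_tradeoff1 : lam = 0 -> tradeoff x @[x --> 1^'-] --> tradeoff 1.
Proof.
move=> l0; rewrite /tradeoff inv_logmean1 l0.
under eq_fun do rewrite mul0r addr0.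
rewrite mul0r addr0; apply: cvgM; last exact: cvg_inv_logmean1.
apply: cvg_at_left_filter; apply: cvgB; first exact: cvg_cst.
by apply: cvgMr; exact: cvg_id.
Unshelve. all: by end_near. Qed.

End cost_function.

(** * The extended cost *)

Section extended_cost.
Context {R : realType}.
Variables (pi D01 D10 lam : R).
Hypotheses (pi01 : 0 < pi < 1) (D01_gt0 : 0 < D01) (D10_gt0 : 0 < D10).
Hypothesis (lam0 : 0 <= lam).
Implicit Types x U V : R.

Let a := (1 - pi) / D01.
Let b := pi / D10.
Let C := ext_cost pi lam D01 D10.
Let dom := cost_domain lam.
Let rcost := reduced_cost pi a b lam.

Let a0 : 0 < a. Proof. by rewrite divr_gt0// subr_gt0; case/andP: pi01. Qed.
Let b0 : 0 < b. Proof. by rewrite divr_gt0//; case/andP: pi01. Qed.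

Lemma costE x U : x < 1 -> 1 < U -> cost pi lam D01 D10 x U = rcost x U.
Proof.
move=> x1 U1; have N0 := normalizer_gt0 pi01 (ltW U1).
rewrite /rcost /reduced_cost /cost /tradeoff inv_logmean_lt1// /a /b.
by field; rewrite !gt_eqF// subr_gt0.
Qed.

Lemma cvg_cost (F : set_system R) {FF : Filter F} U : 1 < U ->
  (\forall x \near F, x < 1) -> tradeoff a b lam x @[x --> F] --> +oo ->
  cost pi lam D01 D10 x U @[x --> F] --> +oo.
Proof.
move=> U1 F1 Foo; have N0 := normalizer_gt0 pi01 (ltW U1).
have c0 : 0 < (U - 1) / (1 + pi * (U - 1)) by rewrite divr_gt0// subr_gt0.
pose A := (- a * ln U + b * (U * ln U) + lam) / (1 + pi * (U - 1)).
apply: ger_cvgy (cvgy_affine A c0 Foo); apply: filterS F1 => x x1.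
by rewrite costE// /rcost reduced_cost_affine.
Qed.

Lemma ext_cost_interior x U : 0 < x < 1 -> C x U = (cost pi lam D01 D10 x U)%:E.
Proof. by move=> /andP[x0 x1]; rewrite /C /ext_cost gt_eqF// lt_eqF. Qed.

Lemma ext_cost_pinfty x U : 1 < U -> 0 <= x <= 1 -> x \notin dom ->
  C x U = +oo%E.
Proof.
move=> U1 /andP[]; rewrite le_eqVlt /dom mem_cost_domain.
move=> /predU1P[<- _ _|x0].
  rewrite /C /ext_cost eqxx; apply/cvg_lim => //; apply/cvgeryP.
  by apply: cvg_cost => //; [exact: nbhs_right_lt|exact: cvg_tradeoff0].
rewrite le_eqVlt => /predU1P[->|x1]; last by rewrite x0 x1 !orbT.
rewrite ltr01 eqxx ltxx/= => lam_neq0.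
rewrite /C /ext_cost oner_eq0 eqxx; apply/cvg_lim => //; apply/cvgeryP.
apply: cvg_cost => //; first exact: nbhs_left_lt.
by apply: cvg_tradeoff1_pinfty => //; rewrite lt_neqAle eq_sym lam_neq0.
Qed.

Lemma ext_cost_fin x U : 1 < U -> x \in dom -> C x U = (rcost x U)%:E.
Proof.
move=> U1; rewrite /dom mem_cost_domain => /and3P[x0].
rewrite le_eqVlt => /predU1P[->|x1 _]; last first.
  by rewrite ext_cost_interior ?x0// costE.
rewrite ltxx/= => /eqP l0.
have N0 := normalizer_gt0 pi01 (ltW U1).
rewrite /C /ext_cost oner_eq0 eqxx; apply/cvg_lim => //.
apply: cvg_EFin; first by near=> y.
have : rcost x U @[x --> 1^'-] --> rcost 1 U.
  rewrite /rcost; under eq_fun do rewrite reduced_cost_affine//.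
  rewrite reduced_cost_affine//.
  apply: cvgD; first exact: cvg_cst.
  by apply: cvgMr; exact: cvg_tradeoff1.
by apply: cvg_trans; apply: near_eq_cvg; near=> y; rewrite /= costE.
Unshelve. all: by end_near. Qed.

(** Only points of [cost_domain] need the convexity of the tradeoff: if x or y
    lies outside it, the right-hand side is +oo. *)
Lemma ext_cost_strongly_convex U : 1 < U ->
  strongly_convex `]0, 1] (fun x => C x U).
Proof.
move=> U1; have N0 := normalizer_gt0 pi01 (ltW U1).
have c0 : 0 < (U - 1) / (1 + pi * (U - 1)) by rewrite divr_gt0// subr_gt0.
have Cy x : x \in `]0, 1] -> x \notin dom -> C x U = +oo%E.
  by rewrite in_itv/= => /andP[x0 x1]; apply: ext_cost_pinfty => //; rewrite ltW.
have CNy x : x \in `]0, 1] -> (-oo < C x U)%E.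
  move=> xI; have [xd|/(Cy _ xI)->//] := boolP (x \in dom).
  by rewrite ext_cost_fin// ltNyr.
have aux t x : 0 < t -> x \in `]0, 1] -> (-oo < t%:E * C x U)%E.
  move=> t0 xI; have [xd|/(Cy _ xI)->] := boolP (x \in dom).
    by rewrite ext_cost_fin// -EFinM ltNyr.
  by rewrite gt0_muley ?lte_fin.
split=> //; exists ((U - 1) / (1 + pi * (U - 1)) * (a * (2 / 3))).
  by rewrite mulr_gt0// mulr_gt0// divr_gt0.
move=> x y t xI yI t01; have /andP[t0 t1] := t01.
have s0 : 0 < 1 - t by lra.
have [xd|/(Cy _ xI) xy] := boolP (x \in dom); last first.
  rewrite xy gt0_muley ?lte_fin// addye; last by rewrite gt_eqF// aux.
  by rewrite leey.
have [yd|/(Cy _ yI) yy] := boolP (y \in dom); last first.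
  rewrite yy gt0_muley ?lte_fin// addey; last by rewrite gt_eqF// aux.
  by rewrite leey.
rewrite !ext_cost_fin// ?conv_in_itv//.
rewrite -!EFinM -!EFinD lee_fin /rcost !reduced_cost_affine//.
have := ler_wpM2l (ltW c0) (tradeoff_convex a0 b0 lam0 xd yd t01).
lra.
Qed.

Lemma ext_cost_nondecreasing x U V : 0 <= x <= 1 -> 1 < U -> U <= V ->
  (C x U <= C x V)%E.
Proof.
move=> x01 U1 UV; have V1 := lt_le_trans U1 UV.
have [xd|xd] := boolP (x \in dom); last by rewrite !ext_cost_pinfty.
rewrite !ext_cost_fin// lee_fin.
by apply: reduced_cost_nondecreasing => //; exact: ltW.
Qed.

Lemma continuous_cost U : {in `]0, 1[, continuous (cost pi lam D01 D10 ^~ U)}.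
Proof.
move=> x; rewrite in_itv/= => /andP[x0 x1].
have cln : ln y @[y --> x] --> ln x by exact: continuous_ln.
have cid : y @[y --> x] --> x by exact: cvg_id.
have cV : (1 - y)^-1 @[y --> x] --> (1 - x)^-1.
  apply: cvgV; first by rewrite gt_eqF// subr_gt0.
  by apply: cvgB => //; exact: cvg_cst.
have cq (c : R) : c / (1 - y) @[y --> x] --> c / (1 - x) by exact: cvgMr.
rewrite /cost; apply: cvgD; first apply: cvgD.
- apply: cvgMr; apply: cvgMl; apply: cvgD; first exact: cvg_cst.
  exact: cvgM.
- apply: cvgMr; apply: cvgMl; apply: cvgD; first exact: cvg_cst.
  by apply: cvgM => //; exact: cvgM.
- apply: cvgMl; apply: cvgMr; apply: cvgM => //.
  by apply: cvgB => //; exact: cvg_cst.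
Qed.

(** For lam = 0 the minimizer is 1, where the lower bound of [tradeoff_ge] is
    attained; for lam > 0 the cost is coercive on ]0, 1[. *)
Lemma ext_cost_minimum U : 1 < U -> exists2 x, x \in dom &
  (forall y, y \in dom -> (C x U <= C y U)%E) /\ (0 < lam -> 0 < x < 1).
Proof.
move=> U1; have N0 := normalizer_gt0 pi01 (ltW U1).
have c0 : 0 < (U - 1) / (1 + pi * (U - 1)) by rewrite divr_gt0// subr_gt0.
move: lam0; rewrite le_eqVlt => /predU1P[l0|lam_gt0].
  have d1 : 1 \in dom by rewrite /dom mem_cost_domain ltr01 lexx -l0 eqxx orbT.
  exists 1 => //; split=> [y yd|]; last by rewrite -l0 ltxx.
  rewrite !ext_cost_fin// lee_fin /rcost !reduced_cost_affine// lerD2l.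
  rewrite (ler_wpM2l (ltW c0))//.
  apply: le_trans (tradeoff_ge a0 b0 lam0 yd).
  by rewrite /tradeoff inv_logmean1 -l0 mul0r; lra.
have [||x xI xmin] := @coercive_min R 0 1 (cost pi lam D01 D10 ^~ U) ltr01
    (@continuous_cost U).
- by apply: cvg_cost => //; [exact: nbhs_right_lt|exact: cvg_tradeoff0].
- by apply: cvg_cost => //; [exact: nbhs_left_lt|exact: cvg_tradeoff1_pinfty].
have domE : dom = `]0, 1[ by rewrite /dom /cost_domain gt_eqF.
exists x; rewrite domE//; split=> [y yI|_]; last by rewrite in_itv in xI.
have /[!in_itv]/= x01 := xI; have /[!in_itv]/= y01 := yI.
by rewrite !ext_cost_interior// lee_fin; exact: xmin.
Qed.

Lemma ext_cost_argmin U : 1 < U -> exists x,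
  [/\ argmin [set x : R | 0 <= x <= 1] (fun x => C x U) = [set x],
      0 <= x <= 1 & 0 < lam -> 0 < x < 1].
Proof.
move=> U1; have [x xd [xmin xlam]] := ext_cost_minimum U1.
have dom01 y : y \in dom -> y \in `]0, 1].
  by rewrite /dom mem_cost_domain in_itv/= => /and3P[-> ->].
have x01 : 0 <= x <= 1.
  by move: (dom01 _ xd); rewrite in_itv/= => /andP[/ltW-> ->].
have xmin' y : 0 <= y <= 1 -> (C x U <= C y U)%E.
  move=> y01; have [/xmin//|yd] := boolP (y \in dom).
  by rewrite (ext_cost_pinfty _ y01)// leey.
exists x; split=> //; apply/seteqP; split=> [y [y01 ymin]|_ ->]; last by split.
have yd : y \in dom.
  apply: contraT => yd; have := ymin _ x01.
  by rewrite (ext_cost_pinfty _ y01)// ext_cost_fin.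
have xyC : C y U = C x U.
  by apply/eqP; rewrite eq_le ymin// xmin'.
apply: (strongly_convex_argmin_uniq (ext_cost_strongly_convex U1) (r := rcost x U)).
- exact: dom01.
- exact: dom01.
- by rewrite xyC ext_cost_fin.
- by rewrite ext_cost_fin.
move=> z; rewrite in_itv/= => /andP[z0 z1].
by rewrite -ext_cost_fin//; apply: xmin'; rewrite ltW.
Qed.

End extended_cost.

(** * The optimal lower threshold *)

Theorem proposition2 (d : measure_display) (T : measurableType d)
    (R : realType) (mu : {measure set T -> \bar R}) (f0 f1 : T -> R)
    (pi eps lam : R)
    (hpi : 0 < pi < 1) (heps : 0 < eps < 1) (heps_pi : eps < 1 - pi)
    (hlam : 0 <= lam)
    (hf0 : is_density mu f0) (hf1 : is_density mu f1)
    (hdistinct : ~ same_distribution mu f0 f1)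
    (hD01 : (0 < KL mu f0 f1 < +oo)%E) (hD10 : (0 < KL mu f1 f0 < +oo)%E) :
  let C := ext_cost pi lam (fine (KL mu f0 f1)) (fine (KL mu f1 f0)) in
  let dUs := (1 - pi) / pi * ((1 - eps) / eps) in
  (forall dU : R, 1 < dU -> strongly_convex `]0, 1] (fun dL => C dL dU)) /\
  exists dLs : R,
    [/\ fst @` argmin [set p : R * R | dUs <= p.2 /\ 0 <= p.1 <= 1]
                      (fun p => C p.1 p.2) = [set dLs],
        argmin [set dL : R | 0 <= dL <= 1] (fun dL => C dL dUs) = [set dLs] &
        0 < lam -> 0 < dLs < 1].
Proof.
move=> C dUs.
have [D01_gt0 D10_gt0] : 0 < fine (KL mu f0 f1) /\ 0 < fine (KL mu f1 f0).
  by split; apply: fine_gt0.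
have dUs1 : 1 < dUs.
  have /andP[pi0 pi1] := hpi; have /andP[eps0 eps1] := heps.
  (* The claim is (1 - pi) (1 - eps) - pi eps = 1 - pi - eps > 0. *)
  rewrite /dUs mulf_div ltr_pdivlMr ?mulr_gt0// mul1r; nra.
split=> [dU dU1|]; first exact: ext_cost_strongly_convex.
have [x [xargmin x01 xlam]] := ext_cost_argmin hpi D01_gt0 D10_gt0 hlam dUs1.
exists x; split=> //.
have [_ xmin] : argmin [set dL : R | 0 <= dL <= 1] (fun dL => C dL dUs) x.
  by rewrite xargmin.
(* Compare a joint solution (y, U) with (y, dUs) and with (x, dUs). *)
apply/seteqP; split=> [_ [[y U] [/= [dUsU y01] ymin] <-]|_ ->].
  have /(_ (x, dUs)) /= yx := ymin.
  suff : argmin [set dL : R | 0 <= dL <= 1] (fun dL => C dL dUs) y.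
    by rewrite xargmin.
  split=> // z z01; apply: le_trans (xmin _ z01).
  apply: le_trans (yx _); last by split.
  exact: ext_cost_nondecreasing.
exists (x, dUs) => //; split=> [|[y U] [/= dUsU y01]] //=.
apply: le_trans (xmin _ y01) _.
exact: ext_cost_nondecreasing.
Qed.
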